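(* Let $A$ be a Banach algebra and $n\ge0$. Suppose that $A^{[2n]}$ is dense in $A$, and let $B$ be a Banach $A$-bimodule such that $AB^{**}\subseteq B$ and $B^{**}A\subseteq B$. If $H^1(A,B^* )=0$, then $H^1(A,B^{(2n+1)})=0$.
   Context: $A^{[m]}=\{a_1a_2\cdots a_m: a_1,\dots,a_m\in A\}$ (for $n=0$ the density hypothesis is regarded as void). $B^{(m)}$ is the $m$-th dual of $B$, a Banach $A$-bimodule via $\langle b^{(m)}a,b^{(m-1)}\rangle=\langle b^{(m)},ab^{(m-1)}\rangle$ and $\langle ab^{(m)},b^{(m-1)}\rangle=\langle b^{(m)},b^{(m-1)}a\rangle$. $AB^{**}=\{ab'':a\in A,b''\in B^{**}\}$, similarly $B^{**}A$, and $B$ is identified with its canonical image in $B^{**}$. For a Banach $A$-bimodule $E$, a derivation $D:A\to E$ is a bounded linear map with $D(xy)=xD(y)+D(x)y$; it is inner if $D(a)=ae-ea$ for some $e\in E$; $H^1(A,E)$ is the space of derivations modulo inner derivations. *)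

(* Defs.v *)
(* MathComp / MathComp-Analysis. *)
From HB Require Import structures.
From mathcomp Require Import all_boot all_order all_algebra ring_quotient.
From mathcomp Require Import complex.
From mathcomp Require Import boolp classical_sets functions reals topology.
From mathcomp Require Import normedtype.

Set Implicit Arguments.
Unset Strict Implicit.
Unset Printing Implicit Defensive.

Import Order.TTheory GRing.Theory Num.Theory.
Import numFieldNormedType.Exports.

Local Open Scope classical_set_scope.
Local Open Scope ring_scope.

(* Normed spaces are taken over a field [scalars R k] that is either the field
   of real numbers or that of complex numbers. In MathComp-Analysis the norm of
   a normed module over K takes its values in K, so over R[i] norms are complex
   numbers, namely real nonnegative ones. *)
Variant scalar_kind := RealScalars | ComplexScalars.

Definition scalars (R : realType) (k : scalar_kind) : numFieldType :=
  match k with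
  | RealScalars => R : numFieldType
  | ComplexScalars => R[i] : numFieldType
  end.

Section Scalars.
Context (R : realType).

Lemma scalars_sup (k : scalar_kind) (S : set (scalars R k)) :
  S !=set0 -> (forall x, S x -> 0 <= x) -> ubound S !=set0 ->
  supremums S !=set0.
Proof.
case: k S => [|] S /= [x Sx] S0 [M SM].
  have hs : has_sup (S : set R) by split; [exists x | exists M].
  exists (sup (S : set R)); split.
    exact: (sup_upper_bound hs).
  by move=> y Sy; apply: ge_sup => //; exists x.
pose T : set R := [set complex.Re z | z in S].
have hs : has_sup T.
  split; first by exists (complex.Re x), x.
  exists (complex.Re M) => _ [z Sz <-].
  by have := SM _ Sz; rewrite lecE => /andP[].
exists ((sup T)%:C)%C; split => [z Sz|y Sy].
  have z0 := S0 _ Sz.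
  rewrite lecE /= (ger0_Im z0) eqxx /=.
  by apply: sup_upper_bound => //; exists z.
have y0 : 0 <= y by apply: le_trans (S0 _ Sx) (Sy _ Sx).
rewrite lecE /= (ger0_Im y0) eqxx /=.
apply: ge_sup; first by exists (complex.Re x), x.
by move=> _ [z Sz <-]; have := Sy _ Sz; rewrite lecE => /andP[].
Qed.

Lemma complex_complete (F : set_system (R[i])^o) :
  ProperFilter F -> cauchy F -> cvg F.
Proof.
move=> FF /cauchy_ballP Fc.
have ReC (z : R[i]) : (`|complex.Re z|%:C <= `|z|)%C by exact: normc_ge_Re.
have nI : `|'i%C : R[i]| = 1.
  by rewrite normc_def /= expr0n add0r expr1n sqrtr1.
have ImC (z : R[i]) : (`|complex.Im z|%:C <= `|z|)%C.
  have := normc_ge_Re (z * 'i%C).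
  by rewrite ReiNIm normrN normrM nI mulr1.
have c1 : cauchy ((@complex.Re R : (R[i])^o -> R^o) @ F).
  apply/cauchy_ballP => e e0.
  have e0' : 0 < (e%:C)%C :> R[i] by rewrite ltcR.
  rewrite near_map2; apply: filterS (Fc _ e0') => -[z w] /=; rewrite -!ball_normE /= => H.
  rewrite -ltcR; apply: le_lt_trans H.
  by have := ReC (z - w); rewrite raddfB.
have c2 : cauchy ((@complex.Im R : (R[i])^o -> R^o) @ F).
  apply/cauchy_ballP => e e0.
  have e0' : 0 < (e%:C)%C :> R[i] by rewrite ltcR.
  rewrite near_map2; apply: filterS (Fc _ e0') => -[z w] /=; rewrite -!ball_normE /= => H.
  rewrite -ltcR; apply: le_lt_trans H.
  by have := ImC (z - w); rewrite raddfB.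
have [a /cvgrPdist_lt ca] : exists l : R^o,
    (@complex.Re R : (R[i])^o -> R^o) @ F --> l.
  by apply/cvg_ex; apply: R_complete c1.
have [b /cvgrPdist_lt cb] : exists l : R^o,
    (@complex.Im R : (R[i])^o -> R^o) @ F --> l.
  by apply/cvg_ex; apply: R_complete c2.
apply/cvg_ex; exists ((a +i* b)%C : (R[i])^o).
apply/cvgrPdist_lt => e e0.
have eR : e = ((complex.Re e)%:C)%C by rewrite RRe_real // gtr0_real.
have r0 : 0 < complex.Re e / 2.
  by rewrite divr_gt0 //; move: e0; rewrite eR ltcR.
have := ca _ r0; have := cb _ r0; rewrite !near_simpl => Hb Ha.
apply: filterS (filterI Ha Hb) => z [Ha' Hb'].
have -> : (a +i* b)%C - z = ((a - complex.Re z)%:C + 'i * (b - complex.Im z)%:C)%C.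
  by case: z {Ha' Hb'} => u v; simpc.
apply: le_lt_trans (ler_normD _ _) _.
rewrite normrM nI mul1r !normc_def /= !expr0n !addr0 !sqrtr_sqr -rmorphD eR ltcR.
by rewrite [ltRHS]splitr ltrD.
Qed.

Lemma scalars_complete (k : scalar_kind) (F : set_system (scalars R k)^o) :
  ProperFilter F -> cauchy F -> cvg F.
Proof. case: k F => [|] F; [exact: R_complete | exact: complex_complete]. Qed.

End Scalars.

Definition bounded_linear (K : numFieldType) (V W : normedModType K)
    (f : V -> W) : Prop :=
  linear f /\ exists M : K, forall x, `|f x| <= M * `|x|.

(* Banach algebras are not required to have a unit, hence the separate
   multiplication instead of a MathComp ring structure. *)
HB.mixin Record isBanachAlgebra (K : numFieldType) A
    of CompleteNormedModule K A := {
  bmul : A -> A -> A;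
  bmulA : associative bmul;
  bmul_linearl : forall y, linear (bmul^~ y);
  bmul_linearr : forall x, linear (bmul x);
  bmul_norm : forall x y, `|bmul x y| <= `|x| * `|y|
}.

#[short(type="banachAlgType")]
HB.structure Definition BanachAlgebra (K : numFieldType) :=
  {A of CompleteNormedModule K A & isBanachAlgebra K A}.

(* The actions are bounded by some constant, not necessarily 1. *)
HB.mixin Record isBanachBimodule (K : numFieldType) (A : banachAlgType K) B
    of CompleteNormedModule K B := {
  lact : A -> B -> B;
  ract : B -> A -> B;
  lact_linearl : forall x, linear (lact^~ x);
  lact_linearr : forall a, linear (lact a);
  ract_linearl : forall a, linear (ract^~ a);
  ract_linearr : forall x, linear (ract x);
  lactM : forall a b x, lact (bmul a b) x = lact a (lact b x);
  ractM : forall x a b, ract x (bmul a b) = ract (ract x a) b;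
  lractA : forall a x b, ract (lact a x) b = lact a (ract x b);
  lact_bounded : exists C : K, forall a x, `|lact a x| <= C * (`|a| * `|x|);
  ract_bounded : exists C : K, forall x a, `|ract x a| <= C * (`|x| * `|a|)
}.

#[short(type="banachBimodType")]
HB.structure Definition BanachBimodule (K : numFieldType)
    (A : banachAlgType K) :=
  {B of CompleteNormedModule K B & isBanachBimodule K A B}.

Section Dual.
Context (R : realType) (k : scalar_kind).
Local Notation K := (scalars R k).
Context (V : normedModType K).

(* [dual] is the topological dual with the operator norm. The map
   [f : V -> K^o] is K-valued: [K^o] is K as a normed module over itself. *)
Definition functional : {pred V -> K^o} :=
  mem [set f : V -> K^o | bounded_linear f].

Record dual := Dual { dual_val :> V -> K^o; _ : dual_val \in functional }.

HB.instance Definition _ := [isSub for dual_val].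
HB.instance Definition _ := [Choice of dual by <:].

Lemma functional_submod : submod_closed functional.
Proof.
split=> [|a f g].
  apply: mem_set; split=> [c x y|]; first by rewrite /GRing.zero /= scaler0 addr0.
  by exists 0 => x; rewrite mul0r /GRing.zero /= normr0.
move=> /set_mem [lf [M fM]] /set_mem [lg [N gN]]; apply: mem_set; split.
  move=> c x y; rewrite !fctE /= lf lg !scalerDr addrACA !scalerA.
  by rewrite [a * c]mulrC.
exists (`|a| * M + N) => x; rewrite !fctE /=.
apply: le_trans (ler_normD _ _) _.
by rewrite normrZ mulrDl lerD // -mulrA ler_wpM2l.
Qed.

HB.instance Definition _ :=
  GRing.isSubmodClosed.Build K (V -> K^o) functional functional_submod.
HB.instance Definition _ := [SubChoice_isSubLmodule of dual by <:].

Lemma dual_bounded_linear (f : dual) : bounded_linear f.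
Proof. by case: f => f /= /set_mem. Qed.

Lemma dual_linear (f : dual) : linear f.
Proof. exact: (dual_bounded_linear f).1. Qed.

Lemma dualP (f g : dual) : f =1 g -> f = g.
Proof. by move=> fg; apply/val_inj/funext. Qed.

Lemma dualD (f g : dual) x : (f + g) x = f x + g x. Proof. by []. Qed.
Lemma dualN (f : dual) x : (- f) x = - f x. Proof. by []. Qed.
Lemma dualB (f g : dual) x : (f - g) x = f x - g x. Proof. by []. Qed.
Lemma dualZ (a : K) (f : dual) x : (a *: f) x = a * f x. Proof. by []. Qed.

Lemma dual0r (f : dual) : f 0 = 0.
Proof.
by have := dual_linear f 1 0 0; rewrite !scale1r addr0 -{1}[f 0]addr0 => /addrI.
Qed.

Lemma dualZr (f : dual) a x : f (a *: x) = a * f x.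
Proof. by have := dual_linear f a x 0; rewrite !addr0 dual0r addr0. Qed.

(* For each f in the dual, [supremum] is a genuine least upper bound here, see
   [opnorm_sup]. *)
Definition opnorm (f : dual) : K :=
  supremum 0 [set `|f x| | x in [set x : V | `|x| <= 1]].

Lemma opnorm_sup (f : dual) :
  supremums [set `|f x| | x in [set x : V | `|x| <= 1]] (opnorm f).
Proof.
have S0 : [set `|f x| | x in [set x : V | `|x| <= 1]] !=set0.
  by exists `|f 0|, 0 => //=; rewrite normr0 ler01.
rewrite /opnorm /supremum ifF; last by apply/negbTE/set0P.
have [M fM] := (dual_bounded_linear f).2.
have [s Hs] : supremums [set `|f x| | x in [set x : V | `|x| <= 1]] !=set0.
  apply: scalars_sup => //; first by move=> _ [x _ <-].
  exists `|M| => _ [x /= x1 <-]; apply: le_trans (fM x) _.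
  have [->|xn0] := eqVneq x 0; first by rewrite normr0 mulr0.
  have M0 : 0 <= M.
    have := le_trans (normr_ge0 _) (fM x).
    by rewrite pmulr_lge0 // normr_gt0.
  by rewrite (ger0_norm M0) ler_piMr.
exact: (xgetPex 0 (ex_intro _ s Hs)).
Qed.

Lemma opnorm_ge0 f : 0 <= opnorm f.
Proof.
apply: le_trans (normr_ge0 (f 0)) _.
by apply: (opnorm_sup f).1; exists 0 => //=; rewrite normr0 ler01.
Qed.

Lemma ler_opnorm (f : dual) x : `|f x| <= opnorm f * `|x|.
Proof.
have [->|xn0] := eqVneq x 0; first by rewrite dual0r !normr0 mulr0.
have x0 : 0 < `|x| by rewrite normr_gt0.
have : `|f (`|x|^-1 *: x)| <= opnorm f.
  apply: (opnorm_sup f).1; exists (`|x|^-1 *: x) => //=.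
  by rewrite normrZ normfV normr_id mulVf // gt_eqF.
by rewrite dualZr normrM normfV normr_id mulrC ler_pdivrMr.
Qed.

Lemma opnorm_le (f : dual) (M : K) :
  0 <= M -> (forall x, `|f x| <= M * `|x|) -> opnorm f <= M.
Proof.
move=> M0 fM; apply: (opnorm_sup f).2 => _ [x /= x1 <-].
by apply: le_trans (fM x) _; rewrite ler_piMr.
Qed.

Lemma opnormD f g : opnorm (f + g) <= opnorm f + opnorm g.
Proof.
apply: opnorm_le => [|x]; first by rewrite addr_ge0 ?opnorm_ge0.
rewrite dualD mulrDl; apply: le_trans (ler_normD _ _) _.
by rewrite lerD ?ler_opnorm.
Qed.

Lemma opnormZ_le (a : K) f : opnorm (a *: f) <= `|a| * opnorm f.
Proof.
apply: opnorm_le => [|x]; first by rewrite mulr_ge0 ?opnorm_ge0.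
by rewrite dualZ normrM -mulrA ler_wpM2l // ler_opnorm.
Qed.

Lemma opnormZ (a : K) f : opnorm (a *: f) = `|a| * opnorm f.
Proof.
have [->|an0] := eqVneq a 0.
  apply/le_anti; rewrite opnormZ_le /= normr0 mul0r; exact: opnorm_ge0.
apply/le_anti; rewrite opnormZ_le /=.
have := opnormZ_le a^-1 (a *: f).
by rewrite scalerA mulVf // scale1r normfV mulrC ler_pdivlMr ?normr_gt0 // mulrC.
Qed.

Lemma opnorm_eq0 f : opnorm f = 0 -> f = 0.
Proof.
move=> f0; apply: dualP => x; apply/eqP; rewrite -normr_le0.
by have := ler_opnorm f x; rewrite f0 mul0r.
Qed.

HB.instance Definition _ :=
  Lmodule_isNormed.Build K dual opnormD opnormZ opnorm_eq0.

Lemma dual_normE (f : dual) : `|f| = opnorm f. Proof. by []. Qed.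

Lemma dual_complete (F : set_system dual) :
  ProperFilter F -> cauchy F -> cvg F.
Proof.
move=> FF /cauchy_ballP Fc.
have Fx (x : V) : exists l : K^o, (fun f : dual => f x : K^o) @ F --> l.
  apply/cvg_ex; apply: scalars_complete.
  have FxF : ProperFilter ((fun f : dual => f x : K^o) @ F).
    exact: fmap_proper_filter.
  apply/cauchy_ballP => e e0.
  have e0' : 0 < e / (`|x| + 1) by rewrite divr_gt0 // ltr_wpDl.
  rewrite near_map2; apply: filterS (Fc _ e0') => -[f g] /=.
  rewrite -!ball_normE /= => fg.
  rewrite -[X in `|X|]dualB; apply: le_lt_trans (ler_opnorm _ _) _.
  have x1 : 0 < `|x| + 1 by rewrite ltr_wpDl.
  apply: (@le_lt_trans _ _ (opnorm (f - g) * (`|x| + 1))).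
    by rewrite ler_wpM2l ?opnorm_ge0 // lerDl.
  by rewrite -ltr_pdivlMr.
have [g gP] := choice Fx.
have gl : linear (g : V -> K^o).
  move=> a x y; have := gP (a *: x + y).
  have -> : (fun f : dual => f (a *: x + y) : K^o)
          = (fun f : dual => a *: (f x : K^o) + f y).
    by apply/funext => f; rewrite dual_linear.
  move=> H; have H' : (fun f : dual => a *: (f x : K^o) + f y) @ F
      --> (a *: (g x : K^o) + g y : K^o).
    by apply: cvgD; [apply: cvgZr; exact: gP | exact: gP].
  exact: (@norm_cvg_unique _ K^o _ (fmap_proper_filter _ FF) _ _ H H').
have Hn (e : K) : 0 < e ->
    F [set f : dual | forall x, `|f x - g x| <= e * `|x|].
  move=> e0; have [[P Q] [FP FQ] PQ] := Fc _ e0.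
  apply: filterS FP => f Pf x; apply/ler_addgt0Pl => d d0.
  have /cvgrPdist_lt/(_ _ d0) := gP x; rewrite near_simpl => Hd.
  have [h [Qh hd]] := filter_ex (filterI FQ Hd).
  have := PQ (f, h) (conj Pf Qh); rewrite /= -ball_normE /= => fh.
  rewrite -(subrK (h x) (f x)) -addrA addrC.
  apply: le_trans (ler_normD _ _) _; apply: lerD.
    by rewrite distrC ltW.
  rewrite -dualB; apply: le_trans (ler_opnorm _ _) _.
  by rewrite ler_wpM2r // ltW.
have [f0 Hf0] := filter_ex (Hn 1 ltr01).
have gb : bounded_linear (g : V -> K^o).
  split=> //; exists (opnorm f0 + 1) => x.
  rewrite -(subrK (f0 x) (g x)) addrC mulrDl.
  by apply: le_trans (ler_normD _ _) _; rewrite lerD ?ler_opnorm // distrC.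
apply/cvg_ex; exists (Dual (mem_set gb)).
apply/cvgrPdist_le => e e0.
apply: filterS (Hn _ e0) => f Hf; rewrite -normrN opprB.
by apply: opnorm_le; first exact: ltW.
Qed.

HB.instance Definition _ := Uniform_isComplete.Build dual dual_complete.

End Dual.

Arguments functional {R k} V.


Section DualBimodule.
Context (R : realType) (k : scalar_kind).
Local Notation K := (scalars R k).
Context (A : banachAlgType K) (B : banachBimodType A).

Lemma dual_lact_subproof (a : A) (f : dual B) :
  ((fun x : B => f (ract x a)) : B -> K^o) \in functional B.
Proof.
apply: mem_set; split=> [c x y|]; first by rewrite ract_linearl dual_linear.
have [C HC] := ract_bounded (s := B).
exists (`|f| * (C * `|a|)) => x; apply: le_trans (ler_opnorm _ _) _.
by rewrite -mulrA ler_wpM2l ?opnorm_ge0 // mulrAC -mulrA HC.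
Qed.

Lemma dual_ract_subproof (f : dual B) (a : A) :
  ((fun x : B => f (lact a x)) : B -> K^o) \in functional B.
Proof.
apply: mem_set; split=> [c x y|]; first by rewrite lact_linearr dual_linear.
have [C HC] := lact_bounded (s := B).
exists (`|f| * (C * `|a|)) => x; apply: le_trans (ler_opnorm _ _) _.
by rewrite -mulrA ler_wpM2l ?opnorm_ge0 // -mulrA HC.
Qed.

(* <a f, x> = <f, x a> and <f a, x> = <f, a x>. *)
Definition dual_lact (a : A) (f : dual B) : dual B :=
  Dual (dual_lact_subproof a f).
Definition dual_ract (f : dual B) (a : A) : dual B :=
  Dual (dual_ract_subproof f a).

Lemma dual_lact_linearl (f : dual B) : linear (dual_lact^~ f).
Proof.
move=> c a b; apply: dualP => x.
by rewrite dualD dualZ /= ract_linearr dual_linear.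
Qed.

Lemma dual_lact_linearr (a : A) : linear (dual_lact a).
Proof. by move=> c f g; apply: dualP. Qed.

Lemma dual_ract_linearl (a : A) : linear (dual_ract^~ a).
Proof. by move=> c f g; apply: dualP. Qed.

Lemma dual_ract_linearr (f : dual B) : linear (dual_ract f).
Proof.
move=> c a b; apply: dualP => x.
by rewrite dualD dualZ /= lact_linearl dual_linear.
Qed.

Lemma dual_lactM a b f :
  dual_lact (bmul a b) f = dual_lact a (dual_lact b f).
Proof. by apply: dualP => x /=; rewrite ractM. Qed.

Lemma dual_ractM f a b :
  dual_ract f (bmul a b) = dual_ract (dual_ract f a) b.
Proof. by apply: dualP => x /=; rewrite lactM. Qed.

Lemma dual_lractA a f b :
  dual_ract (dual_lact a f) b = dual_lact a (dual_ract f b).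
Proof. by apply: dualP => x /=; rewrite lractA. Qed.

Lemma bound_norm (C : K) (t : K) (u : K) :
  0 <= t -> 0 <= u -> u <= C * t -> u <= `|C| * t.
Proof.
rewrite le_eqVlt => /predU1P[<-|t0] u0; first by rewrite !mulr0.
move=> h; rewrite ger0_norm //.
by have := le_trans u0 h; rewrite pmulr_lge0.
Qed.

Lemma dual_lact_bounded :
  exists C : K, forall a f, `|dual_lact a f| <= C * (`|a| * `|f|).
Proof.
have [C HC] := ract_bounded (s := B); exists `|C| => a f.
apply: opnorm_le => [|x]; first by rewrite !mulr_ge0.
apply: le_trans (ler_opnorm f (ract x a)) _.
rewrite (mulrC `|a| `|f|) (mulrCA `|C|) -!mulrA (mulrC `|a| `|x|).
apply: ler_wpM2l; first exact: opnorm_ge0.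
by apply: bound_norm; rewrite ?mulr_ge0.
Qed.

Lemma dual_ract_bounded :
  exists C : K, forall f a, `|dual_ract f a| <= C * (`|f| * `|a|).
Proof.
have [C HC] := lact_bounded (s := B); exists `|C| => f a.
apply: opnorm_le => [|x]; first by rewrite !mulr_ge0.
apply: le_trans (ler_opnorm f (lact a x)) _.
rewrite (mulrCA `|C|) -!mulrA (mulrC `|a| `|x|).
apply: ler_wpM2l; first exact: opnorm_ge0.
rewrite (mulrC `|x|); by apply: bound_norm; rewrite ?mulr_ge0.
Qed.

HB.instance Definition _ := isBanachBimodule.Build K A (dual B)
  dual_lact_linearl dual_lact_linearr dual_ract_linearl dual_ract_linearr
  dual_lactM dual_ractM dual_lractA dual_lact_bounded dual_ract_bounded.

Lemma bidual_subproof (b : B) :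
  ((fun f : dual B => f b) : dual B -> K^o) \in functional (dual B).
Proof.
apply: mem_set; split=> [c f g|] //.
by exists `|b| => f; rewrite mulrC ler_opnorm.
Qed.

Definition canonical_embedding (b : B) : dual (dual B) := Dual (bidual_subproof b).

End DualBimodule.

Fixpoint iter_dual (R : realType) (k : scalar_kind)
    (A : banachAlgType (scalars R k)) (m : nat) (B : banachBimodType A) :
    banachBimodType A :=
  if m is m'.+1 then (dual (iter_dual m' B) : banachBimodType A) else B.

Section Cohomology.
Context (K : numFieldType) (A : banachAlgType K) (E : banachBimodType A).

Lemma lact0 a : lact a (0 : E) = 0.
Proof.
have := lact_linearr a 1 (0 : E) 0; rewrite !scale1r !addr0 => /esym /eqP.
by rewrite -subr_eq0 addrK => /eqP.
Qed.

Lemma ract0 a : ract (0 : E) a = 0.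
Proof.
have := ract_linearl a 1 (0 : E) 0; rewrite !scale1r !addr0 => /esym /eqP.
by rewrite -subr_eq0 addrK => /eqP.
Qed.

Definition derivations : {pred A -> E} :=
  mem [set D : A -> E | bounded_linear D /\
    forall x y, D (bmul x y) = lact x (D y) + ract (D x) y].

Lemma derivations_submod : submod_closed derivations.
Proof.
split=> [|c D D'].
  apply: mem_set; split; first split=> [d x y|].
  - by rewrite /GRing.zero /= scaler0 addr0.
  - by exists 0 => x; rewrite mul0r /GRing.zero /= normr0.
  - by move=> x y; rewrite /GRing.zero /= lact0 ract0 addr0.
move=> /set_mem [[lD [M DM]] dD] /set_mem [[lD' [N DN]] dD'].
apply: mem_set; split; first split.
- move=> d x y; rewrite !fctE /= lD lD' !scalerDr addrACA !scalerA.
  by rewrite [c * d]mulrC.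
- exists (`|c| * M + N) => x; rewrite !fctE /=.
  apply: le_trans (ler_normD _ _) _.
  by rewrite normrZ mulrDl lerD // -mulrA ler_wpM2l.
- move=> x y; rewrite !fctE /= dD dD' !(lact_linearr, ract_linearl) scalerDr.
  by rewrite addrACA.
Qed.

HB.instance Definition _ :=
  GRing.isSubmodClosed.Build K (A -> E) derivations derivations_submod.

Record derivation :=
  Derivation { derivation_val :> A -> E; _ : derivation_val \in derivations }.

HB.instance Definition _ := [isSub for derivation_val].
HB.instance Definition _ := [Choice of derivation by <:].
HB.instance Definition _ := [SubChoice_isSubLmodule of derivation by <:].

Definition inner : {pred derivation} :=
  mem [set D : derivation | exists e : E, forall a, D a = lact a e - ract e a].

Lemma inner_zmod : zmod_closed inner.
Proof.
split=> [|D D' /set_mem [e De] /set_mem [e' De']].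
  by apply: mem_set; exists 0 => a; rewrite lact0 ract0 subr0.
apply: mem_set; exists (e - e') => a.
have -> : e - e' = (-1) *: e' + e by rewrite scaleN1r addrC.
rewrite lact_linearr ract_linearl !scaleN1r.
have -> : (D - D') a = D a - D' a by [].
rewrite De De' !opprD !opprK addrACA.
by congr (_ + _); exact: addrC.
Qed.

HB.instance Definition _ := GRing.isZmodClosed.Build derivation inner inner_zmod.

(* MathComp provides the quotient by an additive subgroup; as an additive group
   it is the quotient vector space, which is all that its vanishing involves. *)
Definition H1 := Quotient.quot inner.

HB.instance Definition _ := GRing.Zmodule.on H1.

Lemma H1_eq0P : (forall h : H1, h = 0) <->
  forall D : derivation, exists e : E, forall a, D a = lact a e - ract e a.
Proof.
have P (D : derivation) : (D \in inner) <-> (\pi_(Quotient.quot inner)%qT D = 0).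
  have <- : \pi_(Quotient.quot inner)%qT 0 = 0 by exact: pi_zeror.
  rewrite -[X in X \in _]subr0 Quotient.idealrBE.
  by split=> [/eqP|->].
split=> [H D|H h]; first by have /P/set_mem := H (\pi_(Quotient.quot inner)%qT D).
by rewrite -[h]reprK; apply/P/mem_set/H.
Qed.

End Cohomology.

(* The set of products a_1 a_2 ... a_m with m factors, for m >= 1. It is empty
   for m = 0, as A need not have a unit. *)
Definition product_set (K : numFieldType) (A : banachAlgType K) (m : nat) :
    set A :=
  [set x | exists (a : A) (s : seq A), (size s).+1 = m /\ x = foldl bmul a s].

Arguments canonical_embedding {R k A} B.
Arguments H1 {K} A E.
Arguments product_set {K} A m.

(* Main.v *)
(** Let [i : B -> B^(2n)] be the canonical embedding. A product of [n] elements
    of [A] multiplies [B^(2n)], from either side, into [i(B)]. Given a derivation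
    [D : A -> B^(2n+1)], its restriction [a |-> D a \o i] to [B] is a derivation
    into [B^*], hence is implemented by some [f]. Subtracting from [D] the inner
    derivation of the canonical image of [f] leaves a derivation [D'] whose
    values annihilate [i(B)]. For [x], [y] in [A^[n]] both terms of
    [D' (xy) = x D' y + D' x y] then vanish, so [D'] vanishes on the dense set
    [A^[2n]]. *)
Require Import Defs.
From mathcomp Require Import all_boot all_order all_algebra.
From mathcomp Require Import boolp classical_sets functions reals topology.
From mathcomp Require Import normedtype.

Set Implicit Arguments.
Unset Strict Implicit.
Unset Printing Implicit Defensive.

Import Order.TTheory GRing.Theory Num.Theory.
Import numFieldNormedType.Exports.

Local Open Scope classical_set_scope.
Local Open Scope ring_scope.

(** * Bounded linear maps *)

Section BoundedLinear.
Context (K : numFieldType).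

(** The bound in [bounded_linear] carries no sign condition; a single vector of nonzero norm forces
    it to be nonnegative, and without one any bound works. *)
Lemma bounded_linear_ge0 (V W : normedModType K) (f : V -> W) :
  bounded_linear f -> exists2 M : K, 0 <= M & forall x, `|f x| <= M * `|x|.
Proof.
case=> _ [M fM]; exists `|M| => // x; have fx := fM x.
have [x0|x0] := eqVneq `|x| 0; first by move: fx; rewrite x0 !mulr0.
have M0 : 0 <= M.
  by have := le_trans (normr_ge0 _) fx; rewrite pmulr_lge0 // lt_def x0 /=.
by rewrite ger0_norm.
Qed.

Lemma bounded_linear_id (V : normedModType K) : bounded_linear (@id V).
Proof. by split=> [c x y //|]; exists 1 => x; rewrite mul1r. Qed.

Lemma bounded_linear_comp (U V W : normedModType K) (g : V -> W) (f : U -> V) :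
  bounded_linear g -> bounded_linear f -> bounded_linear (g \o f).
Proof.
move=> gb [lf [M fM]]; have [N N0 gN] := bounded_linear_ge0 gb.
case: gb => lg _; split=> [c x y|]; first by rewrite /= lf lg.
exists (N * M) => x; apply: le_trans (gN _) _.
by rewrite -mulrA ler_wpM2l.
Qed.

Lemma bounded_linear_eq0_dense (V W : normedModType K) (f : V -> W) (S : set V) :
  bounded_linear f -> dense S -> (forall x, S x -> f x = 0) ->
  forall x, f x = 0.
Proof.
move=> fb dS fS x; have [M M0 fM] := bounded_linear_ge0 fb.
have fB u v : f (u - v) = f u - f v.
  by rewrite -scaleN1r addrC fb.1 scaleN1r addrC.
apply/eqP; rewrite -normr_le0; apply/ler_addgt0Pl => e e0; rewrite addr0.
have M1 : 0 < M + 1 by rewrite ltr_wpDl.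
(* [M] may be 0, hence the radius [e / (M + 1)]. *)
have d0 : 0 < e / (M + 1) by rewrite divr_gt0.
have [||y []] := dS (ball x (e / (M + 1))).
- by exists x; exact: ballxx.
- exact: ball_open.
rewrite -ball_normE /= => xy Sy.
rewrite -[f x]subr0 -(fS _ Sy) -fB; apply: le_trans (fM _) _.
apply: (@le_trans _ _ ((M + 1) * `|x - y|)); first by rewrite ler_wpM2r // lerDl.
by rewrite mulrC -ler_pdivlMr // ltW.
Qed.

End BoundedLinear.

(** * Bimodule embeddings with extension of functionals *)

Section Embeddings.
Context (R : realType) (k : scalar_kind).
Local Notation K := (scalars R k).
Context (A : banachAlgType K).

Lemma dual_comp_subproof (V W : normedModType K) (f : dual W) (T : V -> W) :
  bounded_linear T -> (f \o T : V -> K^o) \in functional V.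
Proof.
move=> Tb; apply: mem_set; apply: bounded_linear_comp Tb.
exact: dual_bounded_linear.
Qed.

Definition dual_comp (V W : normedModType K) (f : dual W) (T : V -> W)
  (Tb : bounded_linear T) : dual V := Dual (dual_comp_subproof f Tb).

Lemma canonical_embedding_bounded_linear (B : banachBimodType A) :
  bounded_linear (canonical_embedding B).
Proof.
split=> [c x y|]; first by apply: dualP => f; rewrite dualD dualZ /= dual_linear.
exists 1 => x; rewrite mul1r; apply: opnorm_le => // f.
by rewrite mulrC; exact: (ler_opnorm f x).
Qed.

(* The functional [ext f] extends [f] along [emb]. Carrying a bounded linear
   choice of extensions makes the Hahn-Banach theorem unnecessary. *)
Record split_embedding (B E : banachBimodType A) := SplitEmbedding {
  emb :> B -> E;
  ext : dual B -> dual E;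
  emb_bounded : bounded_linear emb;
  ext_bounded : bounded_linear ext;
  emb_lact : forall a b, emb (lact a b) = lact a (emb b);
  emb_ract : forall b a, emb (ract b a) = ract (emb b) a;
  extE : forall f b, ext f (emb b) = f b }.

Definition id_embedding (B : banachBimodType A) : split_embedding B B :=
  @SplitEmbedding B B id id (bounded_linear_id B) (bounded_linear_id (dual B))
    (fun _ _ => erefl) (fun _ _ => erefl) (fun _ _ => erefl).

Section Bidual.
Context (B E : banachBimodType A) (i : split_embedding B E).

Lemma bidual_lact a b :
  (canonical_embedding E \o i) (lact a b)
  = lact a ((canonical_embedding E \o i) b).
Proof. by apply: dualP => f /=; rewrite emb_lact. Qed.

Lemma bidual_ract b a :
  (canonical_embedding E \o i) (ract b a)
  = ract ((canonical_embedding E \o i) b) a.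
Proof. by apply: dualP => f /=; rewrite emb_ract. Qed.

(** The extension of [f] is evaluation at [ext i f]. On the canonical image of [E] it agrees with
    [ext i f], so [extE i] serves again up to conversion. *)
Definition bidual_embedding : split_embedding B (dual (dual E)) :=
  @SplitEmbedding B (dual (dual E))
    (canonical_embedding E \o i) (canonical_embedding (dual E) \o ext i)
    (bounded_linear_comp (canonical_embedding_bounded_linear E) (emb_bounded i))
    (bounded_linear_comp (canonical_embedding_bounded_linear (dual E))
       (ext_bounded i))
    bidual_lact bidual_ract (extE i).

(* If [x E] is contained in [i(B)], then [x e''] is the image of
   [b'' := (x e'') \o ext i] under the second adjoint of [i]; multiplying by one
   more factor [a] moves [b''] into [B]. *)
Lemma lact_bidual_range (x : A) :
  (forall a (b : dual (dual B)), range (canonical_embedding B) (lact a b)) ->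
  (forall e : E, range i (lact x e)) ->
  forall a (e : dual (dual E)), range bidual_embedding (lact (bmul a x) e).
Proof.
move=> Bl xE a e; pose b := dual_comp (lact x e) (ext_bounded i).
have [c _ cE] := Bl a b; exists c => //; apply: dualP => f /=.
have := congr1 (fun g : dual (dual B) => g (dual_comp f (emb_bounded i))) cE.
(* Both sides are now values of [e]. The two functionals in its argument depend on [y] only through
   [x y], which lies in the range of [i], where [extE] determines the extension. *)
move=> /= ->; congr (dual_val e _); apply: dualP => y /=.
by rewrite lactM; have [z _ <-] := xE y; rewrite extE /= emb_lact.
Qed.

(** Mirror image: [x] acts first here too, so the new factor stands on the right of [x]. *)
Lemma ract_bidual_range (x : A) :
  (forall (b : dual (dual B)) a, range (canonical_embedding B) (ract b a)) ->
  (forall e : E, range i (ract e x)) ->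
  forall (e : dual (dual E)) a, range bidual_embedding (ract e (bmul x a)).
Proof.
move=> Br Ex e a; pose b := dual_comp (ract e x) (ext_bounded i).
have [c _ cE] := Br b a; exists c => //; apply: dualP => f /=.
have := congr1 (fun g : dual (dual B) => g (dual_comp f (emb_bounded i))) cE.
move=> /= ->; congr (dual_val e _); apply: dualP => y /=.
by rewrite ractM; have [z _ <-] := Ex y; rewrite extE /= emb_ract.
Qed.

End Bidual.

(** * Products of several factors, and embeddings into even duals *)

Lemma foldl_bmulA (a b : A) (s : seq A) :
  foldl bmul (bmul a b) s = bmul a (foldl bmul b s).
Proof. by elim: s b => //= c s IH b; rewrite -bmulA IH. Qed.

Lemma product_set1 : product_set A 1 = [set: A].
Proof. by apply/seteqP; split=> // a _; exists a, [::]. Qed.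

(** Products are nested to the left, so detaching the first factor takes associativity, while the
    last one comes off directly. *)
Lemma product_set_consP (n : nat) (z : A) : product_set A n.+2 z ->
  exists a x, product_set A n.+1 x /\ z = bmul a x.
Proof.
case=> a [[|b s] [//= [sn] ->]]; exists a, (foldl bmul b s).
by split; [exists b, s; rewrite sn | exact: foldl_bmulA].
Qed.

Lemma product_set_rconsP (n : nat) (z : A) : product_set A n.+2 z ->
  exists x a, product_set A n.+1 x /\ z = bmul x a.
Proof.
case=> a [s]; case/lastP: s => [|s b] [//= + ->]; rewrite size_rcons => -[sn].
by exists (foldl bmul a s), b; split; [exists a, s; rewrite sn | exact: foldl_rcons].
Qed.

Lemma product_setDP (m n : nat) (z : A) : product_set A (m.+1 + n.+1) z ->
  exists x y, [/\ product_set A m.+1 x, product_set A n.+1 y & z = bmul x y].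
Proof.
elim: m z => [|m IH] z.
  rewrite add1n => /product_set_consP[a [x [xn ->]]].
  by exists a, x; split=> //; rewrite product_set1.
rewrite 2!addSn => /product_set_consP[a [_ [/IH[x [y [[b [s [sm ->]]] yn ->]]] ->]]].
exists (bmul a (foldl bmul b s)), y; split; rewrite ?bmulA //.
by exists a, (b :: s); rewrite /= sm foldl_bmulA.
Qed.

(** Induction on [n]: each passage to a bidual costs one more factor, the first one for the left
    action and the last one for the right action. *)
Lemma iter_dual_embedding (B : banachBimodType A) (n : nat) :
  (forall a (b : dual (dual B)), range (canonical_embedding B) (lact a b)) ->
  (forall (b : dual (dual B)) a, range (canonical_embedding B) (ract b a)) ->
  exists i : split_embedding B (iter_dual n.+1.*2 B),
    forall x, product_set A n.+1 x ->
    forall e, range i (lact x e) /\ range i (ract e x).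
Proof.
move=> Bl Br; elim: n => [|n [i iP]].
  by exists (bidual_embedding (id_embedding B)) => x _ e; split; [exact: Bl|exact: Br].
exists (bidual_embedding i) => z zn e; split.
  have [a [x [xn ->]]] := product_set_consP zn.
  by apply: lact_bidual_range => // e'; have [] := iP _ xn e'.
have [x [a [xn ->]]] := product_set_rconsP zn.
by apply: ract_bidual_range => // e'; have [] := iP _ xn e'.
Qed.

(** * Restricting and correcting derivations *)

Section Cohomology.
Context (B E : banachBimodType A) (i : split_embedding B E).

Lemma derivation_bounded_linear (F : banachBimodType A) (D : derivation F) :
  bounded_linear D.
Proof. by case: D => D /= /set_mem[]. Qed.

Lemma derivationM (F : banachBimodType A) (D : derivation F) x y :
  D (bmul x y) = lact x (D y) + ract (D x) y.
Proof. by case: D => D /= /set_mem[]. Qed.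

Lemma inner_derivation_subproof (F : banachBimodType A) (e : F) :
  (fun a => lact a e - ract e a) \in @derivations _ A F.
Proof.
apply: mem_set; split; first split=> [c x y|].
- by rewrite lact_linearl ract_linearr scalerBr opprD addrACA.
- have [C HC] := lact_bounded (s := F); have [C' HC'] := ract_bounded (s := F).
  exists (C * `|e| + C' * `|e|) => a; apply: le_trans (ler_normB _ _) _.
  rewrite mulrDl lerD // -mulrA //.
  by rewrite (mulrC `|e|).
have lactB (a : A) (u v : F) : lact a (u - v) = lact a u - lact a v.
  by rewrite -scaleN1r addrC lact_linearr scaleN1r addrC.
have ractB (a : A) (u v : F) : ract (u - v) a = ract u a - ract v a.
  by rewrite -scaleN1r addrC ract_linearl scaleN1r addrC.
by move=> x y; rewrite lactB ractB lactM ractM lractA addrA subrK.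
Qed.

Definition inner_derivation (F : banachBimodType A) (e : F) : derivation F :=
  Derivation (inner_derivation_subproof e).

Lemma restriction_subproof (D : derivation (dual E)) :
  (fun a => dual_comp (D a) (emb_bounded i)) \in @derivations _ A (dual B).
Proof.
have [lD _] := derivation_bounded_linear D.
have [M M0 DM] := bounded_linear_ge0 (derivation_bounded_linear D).
have [N N0 iN] := bounded_linear_ge0 (emb_bounded i).
apply: mem_set; split; first split=> [c x y|].
- by apply: dualP => b; rewrite dualD dualZ /= lD.
- exists (M * N) => x; apply: opnorm_le => [|b]; first by rewrite !mulr_ge0.
  apply: le_trans (ler_opnorm (D x) (i b)) _.
  apply: le_trans (ler_wpM2l (opnorm_ge0 _) (iN b)) _.
  rewrite !mulrA ler_wpM2r // mulrAC ler_wpM2r //; exact: DM.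
move=> x y; apply: dualP => b; rewrite dualD /= derivationM dualD /=.
by rewrite emb_ract emb_lact.
Qed.

Definition restriction (D : derivation (dual E)) : derivation (dual B) :=
  Derivation (restriction_subproof D).

Lemma H1_dual_eq0 (S : set A) :
  (forall x, S x -> forall e, range i (lact x e) /\ range i (ract e x)) ->
  dense [set bmul x y | x in S & y in S] ->
  (forall h : H1 A (dual B), h = 0) -> forall h : H1 A (dual E), h = 0.
Proof.
move=> SP dS /H1_eq0P HB; apply/H1_eq0P => D.
have [f fD] := HB (restriction D); exists (ext i f) => a.
pose D' := D - inner_derivation (ext i f).
suff: D' a = 0 by move/eqP; rewrite subr_eq0 => /eqP.
(* On the range of [i], the functional [ext i f] is [f], and [i] commutes with both actions, so [fD]
   applies. *)
have D'i x b : D' x (i b) = 0.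
  have := congr1 (fun g : dual B => g b) (fD x).
  rewrite !dualB /= => ->.
  by rewrite -emb_ract -emb_lact !extE subrr.
clearbody D'; apply: (bounded_linear_eq0_dense (derivation_bounded_linear D') dS).
move=> _ [x Sx [y Sy <-]]; rewrite derivationM; apply: dualP => e; rewrite dualD /=.
(* The two terms are [D' y] at [e x] and [D' x] at [y e]; both points lie in the range of [i]. *)
have [_ [b _ <-]] := SP _ Sx e; rewrite D'i add0r.
by have [[c _ <-] _] := SP _ Sy e; rewrite D'i.
Qed.

End Cohomology.
End Embeddings.

Theorem mainTheorem7 (R : realType) (k : scalar_kind)
    (A : banachAlgType (scalars R k)) (n : nat) (B : banachBimodType A) :
  ((0 < n)%N -> dense (product_set A (2 * n)%N)) ->
  [set lact a b2 | a in [set: A] & b2 in [set: dual (dual B)]]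
    `<=` range (canonical_embedding B) ->
  [set ract b2 a | b2 in [set: dual (dual B)] & a in [set: A]]
    `<=` range (canonical_embedding B) ->
  (forall h : H1 A (iter_dual 1 B), h = 0) ->
  forall h : H1 A (iter_dual (2 * n).+1 B), h = 0.
Proof.
(* For [n = 0] the conclusion is the hypothesis on [H1]. *)
rewrite mul2n; case: n => [//|n] /(_ isT) dA Bl Br HB.
have [||i iP] := @iter_dual_embedding _ _ _ B n.
- by move=> a b; apply: Bl; exists a => //; exists b.
- by move=> b a; apply: Br; exists b => //; exists a.
apply: (H1_dual_eq0 iP) HB => U U0 oU; have [z [Uz zP]] := dA U U0 oU.
exists z; split=> //; move: zP; rewrite -addnn.
move=> /product_setDP[x [y [xn yn ->]]].
by exists x => //; exists y.
Qed.
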